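(* Let $\tau\in\mathbb{C}$ with $\operatorname{Im}\tau>0$, and let $\varepsilon',\varepsilon\in\mathbb{R}$ be arbitrary, so that $\big[{}^{\varepsilon'}_{\varepsilon}\big]\in\mathbb{R}^2$ is any real characteristic. Then $$\theta^2\big[{}^{\varepsilon'}_{\varepsilon}\big](0,\tau)\Big(3\,\theta\big[{}^{3\varepsilon'}_{3\varepsilon}\big](0,\tau)\,\theta'\big[{}^{\varepsilon'}_{\varepsilon}\big](0,\tau)-\theta'\big[{}^{3\varepsilon'}_{3\varepsilon}\big](0,\tau)\,\theta\big[{}^{\varepsilon'}_{\varepsilon}\big](0,\tau)\Big)=e^{6\pi i\varepsilon'}\,\theta'\big[{}^{1/2}_{1/2}\big](0,\tau)\,\theta^3\big[{}^{\frac12-2\varepsilon'}_{\frac12-2\varepsilon}\big](0,\tau).$$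
   Context: For $z\in\mathbb{C}$, $\tau\in\mathbb{C}$ with $\operatorname{Im}\tau>0$, and a characteristic $\big[{}^{\varepsilon'}_{\varepsilon}\big]\in\mathbb{R}^2$ (upper entry $\varepsilon'$, lower entry $\varepsilon$), the theta function with characteristic is $$\theta\big[{}^{\varepsilon'}_{\varepsilon}\big](z,\tau)=\sum_{n\in\mathbb{Z}}\exp\big(\pi i(n+\varepsilon')^2\tau+2\pi i(n+\varepsilon')(z+\varepsilon)\big).$$ The prime denotes the derivative in $z$: $\theta'\big[{}^{\varepsilon'}_{\varepsilon}\big](0,\tau)=\frac{\partial}{\partial z}\theta\big[{}^{\varepsilon'}_{\varepsilon}\big](z,\tau)\big|_{z=0}$. Powers such as $\theta^2[\cdot](0,\tau)$ and $\theta^3[\cdot](0,\tau)$ denote powers of the value $\theta[\cdot](0,\tau)$. *)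

(* Defs.v *)
From Stdlib Require Import Reals ZArith.
From Coquelicot Require Import Coquelicot.

Local Open Scope C_scope.

Definition Cexp (z : C) : C :=
  (exp (Re z) * cos (Im z), exp (Re z) * sin (Im z))%R.

(* Total, like Coquelicot's [Series]: the value is junk unless the series of
   real parts and the series of imaginary parts both converge. *)
Definition CSeries (a : nat -> C) : C :=
  (Series (fun n => Re (a n)), Series (fun n => Im (a n))).

Lemma CSeries_unique (a : nat -> C) (l : C) :
  is_series (K := C_AbsRing) (V := C_NormedModule) a l -> CSeries a = l.
Proof.
intros H.
assert (Hs : forall n, sum_n a n = (sum_n (fun k => Re (a k)) n,
                                    sum_n (fun k => Im (a k)) n)).
{ induction n as [|n IH].
  - rewrite !sum_O. now destruct (a O).
  - rewrite !sum_Sn, IH. now destruct (a (S n)). }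
unfold CSeries. rewrite (surjective_pairing l). f_equal.
- apply is_series_unique.
  assert (Hl : filterlim (fun n => fst (sum_n a n)) eventually (locally (fst l))).
  { eapply filterlim_comp; [exact H | intros P [e He]].
    exists e; intros y Hy; apply He, Hy. }
  eapply filterlim_ext; [|exact Hl]. intros n; exact (f_equal fst (Hs n)).
- apply is_series_unique.
  assert (Hl : filterlim (fun n => snd (sum_n a n)) eventually (locally (snd l))).
  { eapply filterlim_comp; [exact H | intros P [e He]].
    exists e; intros y Hy; apply He, Hy. }
  eapply filterlim_ext; [|exact Hl]. intros n; exact (f_equal snd (Hs n)).
Qed.

(* The sum over all of Z: the indices n >= 0 plus the indices n <= -1. *)
Definition ZSeries (a : Z -> C) : C :=
  CSeries (fun n => a (Z.of_nat n)) + CSeries (fun n => a (- Z.of_nat (S n))%Z).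

(* [eps'] is the upper and [eps] the lower entry of the characteristic.
   The series converges absolutely whenever 0 < Im tau. *)
Definition theta (eps' eps : R) (z tau : C) : C :=
  ZSeries (fun n =>
    Cexp (PI * Ci * (IZR n + eps') ^ 2 * tau
          + 2 * PI * Ci * (IZR n + eps') * (z + eps))).

(* For 0 < Im tau, theta is holomorphic in z, so the total operator [C_derive]
   returns the complex derivative (see [is_C_derive_unique]). *)
Definition theta_z (eps' eps : R) (z tau : C) : C :=
  C_derive (fun w => theta eps' eps w tau) z.

(* Main.v *)
(* Substituting n = p + q + k, m = p - q with k = 0, 1 in the double series gives
     th[s'+t', s+t] th[s'-t', s-t] = sum_k Th[s'+k/2, 2s] Th[t'+k/2, 2t],
   where th is taken at (0, tau) and Th at (0, 2 tau). Weighting the terms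
   gives the same formula with one factor on the left differentiated. Put
     a_k = Th[2eps'+k/2, 4eps],  f_k = Th[eps'+k/2, 2eps],  c_k = Th[k/2, 0].
   As the left-hand side of the theorem is the derivative at w = 0 of
   th[eps](w)^3 th[3eps](-w), the formula for the pairs (3eps, eps) and (eps, eps)
   turns it into 2 (a_0 c_1 - a_1 c_0) (f_0 f_1' - f_1 f_0'). On the right-hand side,
   with h = 1/2 - 2eps, the pair (h, h) makes th[h]^2 a multiple of the first factor
   and, since th[1/2, 1/2] = 0, the pair (1/2, h) makes th'[1/2, 1/2] th[h]
   a multiple of the second. *)

Require Import Defs.
From Stdlib Require Import Reals ZArith Lia Lra FunctionalExtensionality.
From Coquelicot Require Import Coquelicot.

Local Open Scope C_scope.

(** * Limits of complex sequences, reduced to real ones through the modulus *)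

Definition Clim (u : nat -> C) (l : C) : Prop :=
  is_lim_seq (fun n => Cmod (u n - l)) 0.

Lemma Clim_le (u : nat -> C) (l : C) (v : nat -> R) :
  (forall n, Cmod (u n - l) <= v n)%R -> is_lim_seq v 0 -> Clim u l.
Proof.
intros H Hv. apply is_lim_seq_le_le with (u := fun _ => 0%R) (w := v); auto.
- intros n; split; [apply Cmod_ge_0 | apply H].
- apply is_lim_seq_const.
Qed.

Lemma Clim_unique (u : nat -> C) (l l' : C) : Clim u l -> Clim u l' -> l = l'.
Proof.
intros H H'.
assert (Hs := is_lim_seq_plus' _ _ _ _ H H').
assert (Hle : Rbar_le (Cmod (l' - l)) (Finite (0 + 0)%R)).
{ refine (is_lim_seq_le _ _ _ _ _ (is_lim_seq_const _) Hs). intros n; simpl.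
  replace (l' - l) with ((u n - l) + - (u n - l')) by ring.
  eapply Rle_trans; [apply Cmod_triangle|]. rewrite Cmod_opp. lra. }
simpl in Hle.
assert (H0 : l' - l = 0).
{ apply Cmod_eq_0. pose proof (Cmod_ge_0 (l' - l)). lra. }
replace l' with (l' - l + l) by ring. rewrite H0. ring.
Qed.

Lemma Clim_plus (u v : nat -> C) (l m : C) :
  Clim u l -> Clim v m -> Clim (fun n => u n + v n) (l + m).
Proof.
intros Hu Hv. eapply Clim_le.
2:{ replace (Finite 0) with (Finite (0 + 0)%R) by (f_equal; ring).
    exact (is_lim_seq_plus' _ _ _ _ Hu Hv). }
intros n; simpl. replace (u n + v n - (l + m)) with ((u n - l) + (v n - m)) by ring.
apply Cmod_triangle.
Qed.

Lemma Clim_scal (c : C) (u : nat -> C) (l : C) :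
  Clim u l -> Clim (fun n => c * u n) (c * l).
Proof.
intros Hu. eapply Clim_le.
2:{ replace (Finite 0) with (Rbar_mult (Cmod c) 0) by (simpl; f_equal; ring).
    exact (is_lim_seq_scal_l _ (Cmod c) _ Hu). }
intros n; simpl. replace (c * u n - c * l) with (c * (u n - l)) by ring.
rewrite Cmod_mult. lra.
Qed.

Lemma Clim_ext (u v : nat -> C) (l : C) :
  (forall n, u n = v n) -> Clim u l -> Clim v l.
Proof. intros H. apply is_lim_seq_ext. intros n. now rewrite H. Qed.

Lemma Clim_incr (u : nat -> C) (l : C) : Clim (fun n => u (S n)) l -> Clim u l.
Proof. intros H. apply is_lim_seq_incr_1. exact H. Qed.

Lemma Clim_Cmod_le (u : nat -> C) (l : C) (M : R) :
  Clim u l -> (forall n, Cmod (u n) <= M)%R -> (Cmod l <= M)%R.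
Proof.
intros Hu HM.
assert (Hs := is_lim_seq_plus' _ _ _ _ Hu (is_lim_seq_const M)).
assert (Hle : Rbar_le (Cmod l) (Finite (0 + M)%R)).
{ refine (is_lim_seq_le _ _ _ _ _ (is_lim_seq_const _) Hs). intros n; simpl.
  replace l with (- (u n - l) + u n) at 1 by ring.
  eapply Rle_trans; [apply Cmod_triangle|]. rewrite Cmod_opp.
  specialize (HM n). lra. }
simpl in Hle. lra.
Qed.

Lemma is_series_Clim (a : nat -> C) (l : C) :
  is_series (K := C_AbsRing) (V := C_NormedModule) a l ->
  Clim (sum_n (G := C_NormedModule) a) l.
Proof.
intros H. apply is_lim_seq_spec. intros eps.
pose proof (proj1 (filterlim_locally_ball_norm (U := C_NormedModule) _ l) H eps) as [N HN].
exists N. intros n Hn. specialize (HN n Hn).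

rewrite Rminus_0_r, Rabs_pos_eq by apply Cmod_ge_0. exact HN.
Qed.

(** * Series over Z *)

(* The sum over [-N <= n < N]: this asymmetric range makes the index set of
   [a (2 q)] and [a (2 q + 1)] together exactly that of [a] at [2 N]. *)
Fixpoint Zpart (a : Z -> C) (N : nat) : C :=
  match N with
  | O => 0
  | S k => Zpart a k + (a (Z.of_nat k) + a (- Z.of_nat (S k))%Z)
  end.

(** A fixed majorant suffices because theta terms decay like Gaussians; tracking the constant [K]
    makes the tail bounds uniform in parameters. *)
Definition gauge (n : Z) : R := exp (- Rabs (IZR n)).

Definition dominated (a : Z -> C) (K : R) : Prop :=
  forall n, (Cmod (a n) <= K * gauge n)%R.

Definition summable (a : Z -> C) : Prop := exists K, dominated a K.

Lemma gauge_pos (n : Z) : (0 < gauge n)%R.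
Proof. apply exp_pos. Qed.

Lemma gauge_nat (n : nat) : gauge (Z.of_nat n) = exp (- INR n).
Proof.
unfold gauge. rewrite <- INR_IZR_INZ, Rabs_pos_eq; [easy | apply pos_INR].
Qed.

Lemma gauge_opp (n : Z) : gauge (- n) = gauge n.
Proof. unfold gauge. now rewrite opp_IZR, Rabs_Ropp. Qed.

Lemma dominated_ge_0 (a : Z -> C) (K : R) : dominated a K -> (0 <= K)%R.
Proof.
intros H. specialize (H 0%Z). pose proof (Cmod_ge_0 (a 0%Z)).
pose proof (gauge_pos 0). nra.
Qed.

Lemma exp_opp_S (n : nat) : (exp (- INR (S n)) <= exp (- INR n) / 2)%R.
Proof.
rewrite S_INR. replace (- (INR n + 1))%R with (- INR n + -1)%R by ring.
rewrite exp_plus.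
assert (exp (-1) <= / 2)%R.
{ replace (-1)%R with (- (1))%R by ring. rewrite exp_Ropp. apply Rinv_le_contravar; [lra|].
  pose proof (exp_ineq1_le 1). lra. }
pose proof (exp_pos (- INR n)). nra.
Qed.

Lemma is_lim_seq_exp_opp : is_lim_seq (fun n => exp (- INR n)) 0.
Proof.
apply is_lim_seq_le_le with (u := fun _ => 0%R) (w := fun n => ((/ 2) ^ n)%R).
- intros n. split; [apply Rlt_le, exp_pos|].
  induction n as [|n IH]; [simpl; rewrite Ropp_0, exp_0; lra|].
  pose proof (exp_opp_S n). simpl pow. lra.
- apply is_lim_seq_const.
- apply is_lim_seq_geom. rewrite Rabs_pos_eq; lra.
Qed.

(** The bound telescopes: step m adds at most 3/2 K exp(-m), while by [exp_opp_S] the right-hand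
    side grows by at least 2 K exp(-m). *)
Lemma Zpart_tail (a : Z -> C) (K : R) (N j : nat) : dominated a K ->
  (Cmod (Zpart a (N + j) - Zpart a N) <= 4 * K * (exp (- INR N) - exp (- INR (N + j))))%R.
Proof.
intros H. pose proof (dominated_ge_0 _ _ H) as HK.
induction j as [|j IH].
- rewrite Nat.add_0_r. unfold Cminus. rewrite Cplus_opp_r, Cmod_0. lra.
- rewrite Nat.add_succ_r. cbn [Zpart].
  set (m := (N + j)%nat) in *.
  replace (Zpart a m + (a (Z.of_nat m) + a (- Z.of_nat (S m))%Z) - Zpart a N)
    with ((Zpart a m - Zpart a N) + (a (Z.of_nat m) + a (- Z.of_nat (S m))%Z)) by ring.
  eapply Rle_trans; [apply Cmod_triangle|].
  eapply Rle_trans; [apply Rplus_le_compat; [exact IH | apply Cmod_triangle]|].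
  pose proof (H (Z.of_nat m)) as H1. pose proof (H (- Z.of_nat (S m))%Z) as H2.
  rewrite gauge_opp in H2. rewrite gauge_nat in H1, H2.
  pose proof (exp_opp_S m) as H3. pose proof (exp_pos (- INR m)). nra.
Qed.

Lemma Zpart_sum_n (a : Z -> C) (N : nat) :
  Zpart a (S N) = sum_n (G := C_NormedModule) (fun n => a (Z.of_nat n)) N
                  + sum_n (G := C_NormedModule) (fun n => a (- Z.of_nat (S n))%Z) N.
Proof.
induction N as [|N IH].
- rewrite !sum_O. cbn [Zpart]. ring.
- rewrite !sum_Sn. cbn [Zpart] in *. rewrite IH.
  unfold plus; simpl. ring.
Qed.

(** Both halves of [ZSeries] converge by comparison with a geometric series of ratio 1/2, so neither
    [CSeries] takes a junk value. *)
Lemma ZSeries_Clim (a : Z -> C) : summable a -> Clim (Zpart a) (ZSeries a).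
Proof.
intros [K H].
assert (Hg : ex_series (fun n => (K * (/ 2) ^ n)%R)).
{ apply (ex_series_scal_l K (fun n => ((/ 2) ^ n)%R)), ex_series_geom. rewrite Rabs_pos_eq; lra. }
assert (Hn : forall n, (exp (- INR n) <= (/ 2) ^ n)%R).
{ induction n as [|n IH]; [simpl; rewrite Ropp_0, exp_0; lra|].
  pose proof (exp_opp_S n). simpl pow. lra. }
pose proof (dominated_ge_0 _ _ H) as HK.
assert (H1 : ex_series (V := C_CompleteNormedModule) (fun n => a (Z.of_nat n))).
{ eapply ex_series_le; [|exact Hg]. intros n. simpl.
  change (Cmod (a (Z.of_nat n)) <= K * (/ 2) ^ n)%R.
  eapply Rle_trans; [apply H|]. rewrite gauge_nat.
  apply Rmult_le_compat_l; auto. }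
assert (H2 : ex_series (V := C_CompleteNormedModule) (fun n => a (- Z.of_nat (S n))%Z)).
{ eapply ex_series_le; [|exact Hg]. intros n.
  change (Cmod (a (- Z.of_nat (S n))%Z) <= K * (/ 2) ^ n)%R.
  eapply Rle_trans; [apply H|]. rewrite gauge_opp, gauge_nat.
  apply Rmult_le_compat_l; auto.
  pose proof (exp_opp_S n). pose proof (exp_pos (- INR n)). specialize (Hn n). lra. }
destruct H1 as [l1 H1], H2 as [l2 H2].
unfold ZSeries. rewrite (CSeries_unique _ _ H1), (CSeries_unique _ _ H2).
(* [sum_n] at N includes the index N, so it matches [Zpart] at N + 1. *)
apply Clim_incr. eapply Clim_ext.
- intros n; symmetry; apply Zpart_sum_n.
- apply Clim_plus; apply is_series_Clim; assumption.
Qed.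

Lemma ZSeries_unique (a : Z -> C) (l : C) :
  summable a -> Clim (Zpart a) l -> ZSeries a = l.
Proof. intros Ha. apply Clim_unique, ZSeries_Clim, Ha. Qed.

Lemma ZSeries_tail (a : Z -> C) (K : R) (N : nat) : dominated a K ->
  (Cmod (ZSeries a - Zpart a N) <= 4 * K * exp (- INR N))%R.
Proof.
intros H. pose proof (dominated_ge_0 _ _ H) as HK.
apply Clim_Cmod_le with (u := fun j => Zpart a (N + j) - Zpart a N).
- assert (Hl := ZSeries_Clim a (ex_intro _ K H)).
  apply is_lim_seq_incr_n with (N := N) in Hl.
  eapply is_lim_seq_ext; [|exact Hl]. intros n; simpl. f_equal.
  rewrite Nat.add_comm. ring.
- intros j. eapply Rle_trans; [apply Zpart_tail, H|].
  pose proof (exp_pos (- INR (N + j))). nra.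
Qed.

Lemma ZSeries_bound (a : Z -> C) (K : R) :
  dominated a K -> (Cmod (ZSeries a) <= 4 * K)%R.
Proof.
intros H. pose proof (ZSeries_tail a K 0 H) as Ht. cbn [Zpart] in Ht.
simpl INR in Ht. rewrite Ropp_0, exp_0 in Ht.
replace (ZSeries a - 0) with (ZSeries a) in Ht by ring. lra.
Qed.

Lemma ZSeries_ext (a b : Z -> C) : (forall n, a n = b n) -> ZSeries a = ZSeries b.
Proof. intros H. f_equal. now apply functional_extensionality. Qed.

Lemma dominated_plus (a b : Z -> C) (K L : R) :
  dominated a K -> dominated b L -> dominated (fun n => a n + b n) (K + L).
Proof.
intros Ha Hb n. eapply Rle_trans; [apply Cmod_triangle|].
specialize (Ha n). specialize (Hb n). lra.
Qed.

Lemma summable_plus (a b : Z -> C) :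
  summable a -> summable b -> summable (fun n => a n + b n).
Proof. intros [K Ha] [L Hb]. exists (K + L)%R. now apply dominated_plus. Qed.

Lemma summable_scal (c : C) (a : Z -> C) : summable a -> summable (fun n => c * a n).
Proof.
intros [K Ha]. exists (Cmod c * K)%R. intros n. rewrite Cmod_mult, Rmult_assoc.
apply Rmult_le_compat_l; [apply Cmod_ge_0 | apply Ha].
Qed.

Lemma summable_scal_r (c : C) (a : Z -> C) : summable a -> summable (fun n => a n * c).
Proof.
intros [K Ha]. exists (Cmod c * K)%R. intros n. rewrite Cmod_mult, Rmult_comm, Rmult_assoc.
apply Rmult_le_compat_l; [apply Cmod_ge_0 | apply Ha].
Qed.

Lemma Zpart_plus (a b : Z -> C) (N : nat) :
  Zpart (fun n => a n + b n) N = Zpart a N + Zpart b N.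
Proof. induction N as [|N IH]; cbn [Zpart]; [|rewrite IH]; ring. Qed.

Lemma Zpart_scal (c : C) (a : Z -> C) (N : nat) :
  Zpart (fun n => c * a n) N = c * Zpart a N.
Proof. induction N as [|N IH]; cbn [Zpart]; [|rewrite IH]; ring. Qed.

Lemma ZSeries_plus (a b : Z -> C) : summable a -> summable b ->
  ZSeries (fun n => a n + b n) = ZSeries a + ZSeries b.
Proof.
intros Ha Hb. apply ZSeries_unique; [now apply summable_plus|].
eapply Clim_ext; [intros n; symmetry; apply Zpart_plus|].
apply Clim_plus; now apply ZSeries_Clim.
Qed.

Lemma ZSeries_scal (c : C) (a : Z -> C) : summable a ->
  ZSeries (fun n => c * a n) = c * ZSeries a.
Proof.
intros Ha. apply ZSeries_unique; [now apply summable_scal|].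
eapply Clim_ext; [intros n; symmetry; apply Zpart_scal|].
apply Clim_scal; now apply ZSeries_Clim.
Qed.

Lemma minus_scal (a b : Z -> C) :
  (fun n => a n - b n) = (fun n => a n + (-1) * b n).
Proof. apply functional_extensionality. intros n. ring. Qed.

Lemma summable_minus (a b : Z -> C) :
  summable a -> summable b -> summable (fun n => a n - b n).
Proof. intros Ha Hb. rewrite minus_scal. auto using summable_plus, summable_scal. Qed.

Lemma ZSeries_minus (a b : Z -> C) : summable a -> summable b ->
  ZSeries (fun n => a n - b n) = ZSeries a - ZSeries b.
Proof.
intros Ha Hb. rewrite minus_scal, ZSeries_plus, ZSeries_scal; auto using summable_scal. ring.
Qed.

(** * Index changes: shifts and splitting by parity *)

Lemma exp_le (x y : R) : (x <= y)%R -> (exp x <= exp y)%R.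
Proof. intros [H|H]; [now apply Rlt_le, exp_increasing | rewrite H; lra]. Qed.

Lemma gauge_triangle (m d : Z) : (gauge (m + d) * gauge m <= gauge d)%R.
Proof.
unfold gauge. rewrite <- exp_plus. apply exp_le.
rewrite plus_IZR. pose proof (Rabs_triang (IZR m + IZR d) (- IZR m)) as H.
rewrite Rabs_Ropp in H. replace (IZR m + IZR d + - IZR m)%R with (IZR d) in H by ring. lra.
Qed.

Lemma gauge_shift (k n : Z) : (gauge (n + k) <= / gauge k * gauge n)%R.
Proof.
pose proof (gauge_triangle (n + k) (- k)) as H.
replace (n + k + - k)%Z with n in H by lia. rewrite gauge_opp in H.
pose proof (gauge_triangle k n) as H'. pose proof (gauge_pos k).
apply Rmult_le_reg_l with (gauge k); [easy|].
rewrite <- Rmult_assoc, Rinv_r, Rmult_1_l by lra. rewrite Rmult_comm, Z.add_comm. exact H'.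
Qed.

Lemma summable_shift (a : Z -> C) (k : Z) : summable a -> summable (fun n => a (n + k)%Z).
Proof.
intros [K Ha]. pose proof (dominated_ge_0 _ _ Ha). exists (K * / gauge k)%R. intros n.
eapply Rle_trans; [apply Ha|]. rewrite Rmult_assoc.
apply Rmult_le_compat_l; [easy | apply gauge_shift].
Qed.

(** Disposes of boundary terms; [f] will be N or -N. *)
Lemma Clim_terms (a : Z -> C) (f : nat -> Z) : summable a ->
  (forall N, Z.abs (f N) = Z.of_nat N) -> Clim (fun N => a (f N)) 0.
Proof.
intros [K Ha] Hf. apply Clim_le with (v := fun N => (K * exp (- INR N))%R).
- intros N. replace (a (f N) - 0) with (a (f N)) by ring.
  eapply Rle_trans; [apply Ha|]. right. f_equal.
  rewrite <- gauge_nat, <- Hf. unfold gauge.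
  rewrite abs_IZR, Rabs_Rabsolu. reflexivity.
- replace (Finite 0) with (Rbar_mult K 0) by (simpl; f_equal; ring).
  apply is_lim_seq_scal_l, is_lim_seq_exp_opp.
Qed.

Lemma ZSeries_succ (a : Z -> C) : summable a -> ZSeries (fun n => a (n + 1)%Z) = ZSeries a.
Proof.
intros Ha. apply ZSeries_unique; [now apply summable_shift|].
(* Shifting moves the range from [-N, N) to (-N, N]: it gains the term at N and loses the one at
   -N. *)
apply Clim_ext with (u := fun N => Zpart a N
  + (a (Z.of_nat N) + (-1) * a (- Z.of_nat N)%Z)).
- induction n as [|n IH]; [cbn [Zpart]; simpl; ring|]. cbn [Zpart].
  rewrite <- IH.
  replace (Z.of_nat n + 1)%Z with (Z.of_nat (S n)) by lia.
  replace (- Z.of_nat (S n) + 1)%Z with (- Z.of_nat n)%Z by lia. ring.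
- replace (ZSeries a) with (ZSeries a + (0 + (-1) * 0)) by ring.
  apply Clim_plus; [now apply ZSeries_Clim|].
  apply Clim_plus; [|apply Clim_scal]; apply Clim_terms; auto; intros; lia.
Qed.

Lemma ZSeries_shift (a : Z -> C) (k : Z) : summable a ->
  ZSeries (fun n => a (n + k)%Z) = ZSeries a.
Proof.
intros Ha. induction k as [|k IH|k IH] using Z.peano_ind.
- apply ZSeries_ext. intros n. f_equal. lia.
- rewrite <- IH, <- (ZSeries_succ (fun n => a (n + k)%Z)) by now apply summable_shift.
  apply ZSeries_ext. intros n. f_equal. lia.
- rewrite <- IH, <- (ZSeries_succ (fun n => a (n + Z.pred k)%Z)) by now apply summable_shift.
  apply ZSeries_ext. intros n. f_equal. lia.
Qed.

Lemma gauge_double (n k : Z) : (0 <= k <= 1)%Z -> (gauge (2 * n + k) <= exp 1 * gauge n)%R.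
Proof.
intros Hk. unfold gauge. rewrite <- exp_plus. apply exp_le.
rewrite <- !abs_IZR, <- !opp_IZR, <- plus_IZR. apply IZR_le. lia.
Qed.

Lemma summable_double (a : Z -> C) (k : Z) : (0 <= k <= 1)%Z ->
  summable a -> summable (fun n => a (2 * n + k)%Z).
Proof.
intros Hk [K Ha]. pose proof (dominated_ge_0 _ _ Ha). exists (K * exp 1)%R. intros n.
eapply Rle_trans; [apply Ha|]. rewrite Rmult_assoc.
apply Rmult_le_compat_l; [easy | now apply gauge_double].
Qed.

Lemma ZSeries_parity (a : Z -> C) : summable a ->
  ZSeries a = ZSeries (fun q => a (2 * q + 0)%Z) + ZSeries (fun q => a (2 * q + 1)%Z).
Proof.
intros Ha.
rewrite <- ZSeries_plus by (apply summable_double; auto; lia).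
symmetry. apply ZSeries_unique.
{ apply summable_plus; apply summable_double; auto; lia. }
apply Clim_ext with (u := fun N => Zpart a (2 * N)).
- induction n as [|n IH]; [reflexivity|].
  replace (2 * S n)%nat with (S (S (2 * n))) by lia. cbn [Zpart]. rewrite IH.
  replace (Z.of_nat (2 * n)) with (2 * Z.of_nat n + 0)%Z by lia.
  replace (Z.of_nat (S (2 * n))) with (2 * Z.of_nat n + 1)%Z by lia.
  replace (- Z.of_nat (S (S (2 * n))))%Z with (2 * (- Z.of_nat (S n)) + 0)%Z by lia.
  replace (- (2 * Z.of_nat n + 1))%Z with (2 * (- Z.of_nat (S n)) + 1)%Z by lia.
  ring.
- apply (is_lim_seq_subseq (fun n => Cmod (Zpart a n - ZSeries a)) 0 (fun N => (2 * N)%nat)).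
  + apply eventually_subseq. intros; lia.
  + now apply ZSeries_Clim.
Qed.

(** * Double series: exchange of summations and products *)

Lemma ZSeries_dominated (f : Z -> Z -> C) (K : R) :
  (forall m d, (Cmod (f m d) <= K * gauge m * gauge d)%R) ->
  dominated (fun m => ZSeries (f m)) (4 * K).
Proof.
intros H m. rewrite Rmult_assoc. apply ZSeries_bound. intros d. apply H.
Qed.

Lemma ZSeries_Zpart (f : Z -> Z -> C) (N : nat) :
  (forall d, summable (fun m => f m d)) ->
  summable (fun m => Zpart (f m) N) /\
  ZSeries (fun m => Zpart (f m) N) = Zpart (fun d => ZSeries (fun m => f m d)) N.
Proof.
intros H. induction N as [|N [IH1 IH2]]; cbn [Zpart].
- assert (H0 : summable (fun _ => RtoC 0)).
  { exists 0%R. intros n. rewrite Cmod_0. lra. }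
  split; [easy|]. rewrite (ZSeries_ext _ (fun _ => 0 * 0)) by (intros; ring).
  rewrite ZSeries_scal by easy. ring.
- split; [now repeat apply summable_plus|].
  rewrite ZSeries_plus by (repeat apply summable_plus; auto).
  rewrite ZSeries_plus by auto. now rewrite IH2.
Qed.

(** With the inner sum cut at N, the exchange is finite additivity ([ZSeries_Zpart]). Row m then has
    an error of at most 4 K [gauge m] exp(-N), and summing over m costs another factor 4. *)
Lemma ZSeries_exchange (f : Z -> Z -> C) (K : R) :
  (forall m d, (Cmod (f m d) <= K * gauge m * gauge d)%R) ->
  ZSeries (fun m => ZSeries (f m)) = ZSeries (fun d => ZSeries (fun m => f m d)).
Proof.
intros H.
assert (Hm : forall m, dominated (f m) (K * gauge m)) by (intros m d; apply H).
assert (Hd : forall d, dominated (fun m => f m d) (K * gauge d)).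
{ intros d m. specialize (H m d). lra. }
assert (Hs : summable (fun m => ZSeries (f m))).
{ exists (4 * K)%R. now apply ZSeries_dominated. }
symmetry. apply ZSeries_unique.
{ exists (4 * K)%R. apply (ZSeries_dominated (fun d m => f m d)).
  intros d m. specialize (H m d). lra. }
apply Clim_le with (v := fun N => (4 * (4 * K) * exp (- INR N))%R).
- intros N.
  destruct (ZSeries_Zpart f N) as [H1 H2]; [intros d; eexists; apply Hd|].
  rewrite <- H2, <- Cmod_opp.
  replace (- _) with (ZSeries (fun m => ZSeries (f m)) - ZSeries (fun m => Zpart (f m) N)) by ring.
  rewrite <- ZSeries_minus by easy.
  rewrite Rmult_assoc. apply ZSeries_bound. intros m.
  eapply Rle_trans; [apply ZSeries_tail, Hm|]. right. ring.
- replace (Finite 0) with (Rbar_mult (4 * (4 * K))%R 0) by (simpl; f_equal; ring).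
  apply is_lim_seq_scal_l, is_lim_seq_exp_opp.
Qed.

(** One power of [gauge] pays for the change of variables in [ZSeries_mult], the other for
    summability. *)
Definition rapid (a : Z -> C) : Prop :=
  exists K, forall n, (Cmod (a n) <= K * (gauge n * gauge n))%R.

Lemma rapid_summable (a : Z -> C) : rapid a -> summable a.
Proof.
intros [K Ha]. exists K. intros n. eapply Rle_trans; [apply Ha|].
pose proof (gauge_pos n) as H0.
assert (gauge n <= 1)%R.
{ unfold gauge. rewrite <- exp_0. apply exp_le. pose proof (Rabs_pos (IZR n)). lra. }
assert (0 <= K)%R.
{ specialize (Ha n). pose proof (Cmod_ge_0 (a n)).
  assert (0 < gauge n * gauge n)%R by nra. nra. }
apply Rmult_le_compat_l; nra.
Qed.

(* Substitutes [n = p + q + k], [m = p - q] in the double sum over [(n, m)]; the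
   parity [k] of [n - m] makes this a bijection. The square of the gauge absorbs
   the shear [(n, m) |-> (n - m, m)]. *)
Lemma ZSeries_mult (f g : Z -> C) : rapid f -> rapid g ->
  ZSeries f * ZSeries g
  = ZSeries (fun q => ZSeries (fun p => f (p + q + 0)%Z * g (p - q)%Z))
    + ZSeries (fun q => ZSeries (fun p => f (p + q + 1)%Z * g (p - q)%Z)).
Proof.
intros Hf' [L Hg].
assert (Hs : summable f) by now apply rapid_summable.
assert (Hgs : summable g) by (apply rapid_summable; now exists L).
destruct Hs as [K Hf].
assert (Hs : summable f) by now exists K.
assert (HK := dominated_ge_0 _ _ Hf).
assert (HL : (0 <= L)%R).
{ specialize (Hg 0%Z). pose proof (Cmod_ge_0 (g 0%Z)). pose proof (gauge_pos 0).
  assert (0 < gauge 0 * gauge 0)%R by nra. nra. }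
(* Here d stands for the difference n - m of the two indices. *)
set (F := fun m d : Z => f (m + d)%Z * g m).
assert (HF : forall m d, (Cmod (F m d) <= K * L * gauge m * gauge d)%R).
{ intros m d. unfold F. rewrite Cmod_mult.
  eapply Rle_trans; [apply Rmult_le_compat; [apply Cmod_ge_0|apply Cmod_ge_0|apply Hf|apply Hg]|].
  (* One factor [gauge m] turns [gauge (m + d)] into [gauge d]; the other one remains. *)
  pose proof (gauge_triangle m d). pose proof (gauge_pos m).
  replace (K * gauge (m + d) * (L * (gauge m * gauge m)))%R
    with (K * L * gauge m * (gauge (m + d) * gauge m))%R by ring.
  apply Rmult_le_compat_l; [|easy]. apply Rmult_le_pos; [nra|lra]. }
assert (Hd : forall d, summable (fun m => F m d)).
{ intros d. exists (K * L * gauge d)%R. intros m. specialize (HF m d). lra. }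
transitivity (ZSeries (fun m => ZSeries (F m))).
{ rewrite <- ZSeries_scal by easy. apply ZSeries_ext. intros m. unfold F. symmetry.
  rewrite (ZSeries_ext _ (fun d => g m * f (d + m)%Z)).
  - rewrite ZSeries_scal by now apply summable_shift.
    rewrite (ZSeries_shift f) by easy. ring.
  - intros d. rewrite (Z.add_comm d m). ring. }
rewrite (ZSeries_exchange F (K * L)) by easy.
rewrite ZSeries_parity.
2:{ exists (4 * (K * L))%R. apply (ZSeries_dominated (fun d m => F m d)).
    intros d m. specialize (HF m d). lra. }
(* With d = 2 q + k, the shift m = p - q gives m + d = p + q + k. *)
f_equal; apply ZSeries_ext; intros q;
  rewrite <- (ZSeries_shift _ (- q)) by apply Hd; apply ZSeries_ext; intros p;
  unfold F; do 2 f_equal; lia.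
Qed.

Lemma ZSeries_separate (f g : Z -> C) : summable f -> summable g ->
  summable (fun q => ZSeries (fun p => f p * g q)) /\
  ZSeries (fun q => ZSeries (fun p => f p * g q)) = ZSeries f * ZSeries g.
Proof.
intros Hf Hg.
rewrite (functional_extensionality
  (fun q => ZSeries (fun p => f p * g q)) (fun q => ZSeries f * g q)).
- split; [now apply summable_scal | now apply ZSeries_scal].
- intros q. rewrite (ZSeries_ext _ (fun p => g q * f p)) by (intros; ring).
  rewrite ZSeries_scal by easy. ring.
Qed.

(** The two summands are those that a weight P + Q or P - Q produces when one factor is
    differentiated. *)
Lemma ZSeries_separate2 (f g f' g' : Z -> C) :
  summable f -> summable g -> summable f' -> summable g' ->
  ZSeries (fun q => ZSeries (fun p => f p * g q + f' p * g' q))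
  = ZSeries f * ZSeries g + ZSeries f' * ZSeries g'.
Proof.
intros Hf Hg Hf' Hg'.
destruct (ZSeries_separate f g) as [H1 H2]; auto.
destruct (ZSeries_separate f' g') as [H3 H4]; auto.
rewrite <- H2, <- H4, <- ZSeries_plus by easy.
apply ZSeries_ext. intros q. apply ZSeries_plus; now apply summable_scal_r.
Qed.

(** The reflection swaps the halves n >= 0 and n <= -1 from which [ZSeries] is built. *)
Lemma ZSeries_reflect (a : Z -> C) : ZSeries (fun n => a (- n - 1)%Z) = ZSeries a.
Proof.
unfold ZSeries. rewrite Cplus_comm. f_equal; f_equal;
  apply functional_extensionality; intros n; f_equal; lia.
Qed.

(** * The exponential *)

Lemma Cexp_plus (a b : C) : Cexp (a + b) = Cexp a * Cexp b.
Proof.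
unfold Cexp. rewrite re_plus, im_plus. unfold Cmult; simpl.
rewrite exp_plus, cos_plus, sin_plus. f_equal; ring.
Qed.

Lemma Cmod_Cexp (z : C) : Cmod (Cexp z) = exp (Re z).
Proof.
unfold Cmod, Cexp; cbn [fst snd].
pose proof (sin2_cos2 (Im z)) as H. unfold Rsqr in H.
replace (_ + _)%R with ((exp (Re z)) ^ 2)%R.
- apply sqrt_pow2, Rlt_le, exp_pos.
- transitivity (exp (Re z) ^ 2 * (sin (Im z) * sin (Im z) + cos (Im z) * cos (Im z)))%R;
    [rewrite H|]; ring.
Qed.

Lemma Cexp_imaginary (t : R) : Cexp (Ci * t) = (cos t, sin t).
Proof.
unfold Cexp. replace (Re (Ci * t)) with 0%R by (simpl; ring).
replace (Im (Ci * t)) with t by (simpl; ring). rewrite exp_0. f_equal; ring.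
Qed.

Lemma Cexp_0 : Cexp 0 = 1.
Proof.
replace (RtoC 0) with (Ci * RtoC 0) by ring. rewrite Cexp_imaginary, cos_0, sin_0. easy.
Qed.

Lemma Cexp_period (n : Z) : Cexp (2 * PI * Ci * IZR n) = 1.
Proof.
assert (H1 : Cexp (2 * PI * Ci) = 1).
{ replace (2 * PI * Ci) with (Ci * RtoC (2 * PI)) by (rewrite RtoC_mult; ring).
  rewrite Cexp_imaginary, cos_2PI, sin_2PI. easy. }
assert (HS : forall m, Cexp (2 * PI * Ci * IZR (Z.succ m)) = Cexp (2 * PI * Ci * IZR m)).
{ intros m. rewrite succ_IZR, RtoC_plus, Cmult_plus_distr_l, Cmult_1_r, Cexp_plus, H1. ring. }
induction n as [|n IH|n IH] using Z.peano_ind.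
- rewrite Cmult_0_r. apply Cexp_0.
- now rewrite HS.
- now rewrite <- HS, Z.succ_pred.
Qed.

Lemma Rabs_sin_le (x : R) : (Rabs (sin x) <= Rabs x)%R.
Proof.
destruct (MVT_gen sin 0 x cos) as [c [_ Hc]].
- intros y _. apply is_derive_Reals, derivable_pt_lim_sin.
- intros y _. apply continuity_sin.
- rewrite sin_0, !Rminus_0_r in Hc. rewrite Hc, Rabs_mult.
  pose proof (COS_bound c). assert (Rabs (cos c) <= 1)%R by (apply Rabs_le; lra).
  pose proof (Rabs_pos x). nra.
Qed.

Lemma one_minus_cos (x : R) : (1 - cos x = 2 * (sin (x / 2) * sin (x / 2)))%R.
Proof.
replace x with (2 * (x / 2))%R at 1 by field. rewrite cos_2a_sin. ring.
Qed.

(** A global quadratic remainder, needed to differentiate theta term by term. Real and imaginary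
    parts contribute at most t^2 each. *)
Lemma Cexp_imaginary_taylor (t : R) : (Cmod (Cexp (Ci * t) - 1 - Ci * t) <= 2 * t ^ 2)%R.
Proof.
rewrite Cexp_imaginary.
replace ((cos t, sin t) - 1 - Ci * t) with (RtoC (cos t - 1) + Ci * RtoC (sin t - t)).
2:{ apply injective_projections; simpl; ring. }
eapply Rle_trans; [apply Cmod_triangle|].
rewrite Cmod_mult, Cmod_Ci, !Cmod_R, Rmult_1_l.
assert (H1 : (Rabs (cos t - 1) <= t ^ 2)%R).
{ rewrite Rabs_minus_sym, one_minus_cos.
  pose proof (Rabs_sin_le (t / 2)) as H. apply Rsqr_le_abs_1 in H. unfold Rsqr in H.
  rewrite Rabs_pos_eq; nra. }
assert (H2 : (Rabs (sin t - t) <= t ^ 2)%R).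
{ destruct (MVT_gen (fun x => sin x - x)%R 0 t (fun x => cos x - 1)%R) as [c [Hct Hc]].
  - intros y _. auto_derive; [easy|ring].
  - intros y _. apply continuity_pt_minus; [apply continuity_sin | apply derivable_continuous, derivable_id].
  - rewrite sin_0, !Rminus_0_r in Hc. rewrite Hc, Rabs_mult, Rabs_minus_sym, one_minus_cos.
    assert (Hcs : (Rabs c <= Rabs t)%R).
    { revert Hct. unfold Rmin, Rmax. destruct (Rle_dec 0 t); intros;
      unfold Rabs; destruct (Rcase_abs c), (Rcase_abs t); lra. }
    assert (Hs := Rabs_sin_le (c / 2)).
    rewrite Rabs_div, (Rabs_pos_eq 2) in Hs by lra.
    assert (Hb : (Rabs (sin (c / 2)) <= 1)%R) by (apply Rabs_le, SIN_bound).
    rewrite Rabs_mult, (Rabs_pos_eq 2), Rabs_mult by lra.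
    rewrite <- (pow2_abs t). pose proof (Rabs_pos (sin (c / 2))). pose proof (Rabs_pos t).
    (* One sine is bounded by 1, the other by |c| / 2 <= |t| / 2. *)
    assert (2 * (Rabs (sin (c / 2)) * Rabs (sin (c / 2))) <= Rabs t)%R by nra.
    nra. }
lra.
Qed.

(** * Theta constants *)

(** The unsimplified [0 + eps] keeps the term convertible with that of [theta] at z = 0. *)
Definition theta_term (eps' eps : R) (tau : C) (n : Z) : C :=
  Cexp (PI * Ci * (IZR n + eps') ^ 2 * tau + 2 * PI * Ci * (IZR n + eps') * (0 + eps)).

Definition dtheta_term (eps' eps : R) (tau : C) (n : Z) : C :=
  2 * PI * Ci * (IZR n + eps') * theta_term eps' eps tau n.

Definition Th (eps' eps : R) (tau : C) : C := ZSeries (theta_term eps' eps tau).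

(** The termwise z-derivative at 0; [theta_z_DTh] identifies it with [theta_z]. *)
Definition DTh (eps' eps : R) (tau : C) : C := ZSeries (dtheta_term eps' eps tau).

Lemma Cmod_theta_term (eps' eps : R) (tau : C) (n : Z) :
  Cmod (theta_term eps' eps tau n) = exp (- (PI * Im tau) * (IZR n + eps') ^ 2).
Proof.
unfold theta_term. rewrite Cmod_Cexp. f_equal. destruct tau as [x y].
rewrite <- RtoC_plus, <- RtoC_pow. simpl. ring.
Qed.

(** The factor exp |n + x0| leaves room for polynomial weights. *)
Lemma gaussian_bound (A x0 : R) : (0 < A)%R -> exists K : R, (0 <= K)%R /\
  forall n, (exp (- A * (IZR n + x0) ^ 2) * exp (Rabs (IZR n + x0))
             <= K * (gauge n * gauge n))%R.
Proof.
(* With y = |n + x0| and |n| <= y + |x0|, it remains to bound 3 y - A y^2, whose maximum is 9 / (4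
   A). *)
intros HA. exists (exp (9 / (4 * A) + 2 * Rabs x0)).
split; [apply Rlt_le, exp_pos|]. intros n.
unfold gauge. rewrite <- !exp_plus. apply exp_le.
set (x := (IZR n + x0)%R).
assert (H : (Rabs (IZR n) <= Rabs x + Rabs x0)%R).
{ replace (IZR n) with (x + - x0)%R by (unfold x; ring).
  rewrite <- (Rabs_Ropp x0). apply Rabs_triang. }
rewrite <- (pow2_abs x). set (y := Rabs x) in *.
assert (HB : (0 <= A * (y - 3 / (2 * A)) ^ 2)%R) by (apply Rmult_le_pos; [lra | apply pow2_ge_0]).
replace (A * (y - 3 / (2 * A)) ^ 2)%R with (A * y ^ 2 - 3 * y + 9 / (4 * A))%R in HB by (field; lra).
lra.
Qed.

Lemma pow_le_exp_Rabs (x : R) :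
  (1 <= exp (Rabs x) /\ Rabs x <= exp (Rabs x) /\ x ^ 2 <= 4 * exp (Rabs x))%R.
Proof.
pose proof (Rabs_pos x). pose proof (exp_ineq1_le (Rabs x)).
repeat split; try lra.
rewrite <- (pow2_abs x). pose proof (exp_ineq1_le (Rabs x / 2)) as H1.
replace (Rabs x) with (Rabs x / 2 + Rabs x / 2)%R at 2 by field.
rewrite exp_plus. nra.
Qed.

(** Used with the weight 1 for theta, a linear weight for its derivative and a quadratic one for the
    Taylor remainder. *)
Lemma rapid_weighted_theta_term (eps' eps : R) (tau : C) (w : Z -> C) (L : R) :
  (0 < Im tau)%R -> (0 <= L)%R ->
  (forall n, Cmod (w n) <= L * exp (Rabs (IZR n + eps')))%R ->
  rapid (fun n => w n * theta_term eps' eps tau n).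
Proof.
intros Ht HL Hw.
destruct (gaussian_bound (PI * Im tau) eps') as [K [HK H]].
{ apply Rmult_lt_0_compat; [apply PI_RGT_0 | easy]. }
exists (L * K)%R. intros n. rewrite Cmod_mult, Cmod_theta_term.
eapply Rle_trans; [apply Rmult_le_compat_r; [apply Rlt_le, exp_pos | apply Hw]|].
rewrite !Rmult_assoc. apply Rmult_le_compat_l; [easy|].
rewrite Rmult_comm. apply H.
Qed.

Lemma rapid_theta_term (eps' eps : R) (tau : C) :
  (0 < Im tau)%R -> rapid (theta_term eps' eps tau).
Proof.
intros Ht.
destruct (rapid_weighted_theta_term eps' eps tau (fun _ => 1) 1) as [K H]; auto.
- lra.
- intros n. rewrite Cmod_1. pose proof (pow_le_exp_Rabs (IZR n + eps')). lra.
- exists K. intros n. rewrite <- (Cmult_1_l (theta_term eps' eps tau n)). apply H.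
Qed.

Lemma Cmod_weight (eps' : R) (n : Z) :
  Cmod (2 * PI * Ci * (IZR n + eps')) = (2 * PI * Rabs (IZR n + eps'))%R.
Proof.
rewrite <- RtoC_plus, !Cmod_mult, Cmod_Ci, !Cmod_R, (Rabs_pos_eq 2), (Rabs_pos_eq PI); try lra.
apply Rlt_le, PI_RGT_0.
Qed.

Lemma rapid_dtheta_term (eps' eps : R) (tau : C) :
  (0 < Im tau)%R -> rapid (dtheta_term eps' eps tau).
Proof.
intros Ht. pose proof PI_RGT_0. unfold dtheta_term.
apply (rapid_weighted_theta_term eps' eps tau
  (fun n => 2 * PI * Ci * (IZR n + eps')) (2 * PI)); auto; [lra|].
intros n. rewrite Cmod_weight. pose proof (pow_le_exp_Rabs (IZR n + eps')).
apply Rmult_le_compat_l; lra.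
Qed.

(** * Termwise differentiation in z *)

(** [C_lim] takes its limits along real increments, componentwise, so a quadratic remainder for real
    h determines the value of [C_derive]. *)
Lemma C_derive_of_bound (f : C -> C) (l : C) (M : R) :
  (forall h : R, Cmod (f h - f 0 - h * l) <= M * h ^ 2)%R -> C_derive f 0 = l.
Proof.
intros H.
assert (HM : (0 <= M)%R).
{ specialize (H 1%R). pose proof (Cmod_ge_0 (f 1%R - f 0 - 1%R * l)). lra. }
assert (Hq : forall h : R, h <> 0%R -> (Cmod ((f h - f 0) / (RtoC h - 0) - l) <= M * Rabs h)%R).
{ intros h Hh.
  assert (Hc : RtoC h <> 0) by (intros E; apply Hh, RtoC_inj, E).
  replace ((f h - f 0) / (RtoC h - 0) - l) with ((f h - f 0 - h * l) / h)
    by (field; exact Hc).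
  rewrite Cmod_div, Cmod_R by easy.
  pose proof (Rabs_pos_lt h Hh) as Hp.
  apply Rmult_le_reg_r with (Rabs h); [easy|].
  unfold Rdiv. rewrite Rmult_assoc, Rinv_l, Rmult_1_r by lra.
  eapply Rle_trans; [apply H|]. rewrite <- (pow2_abs h). lra. }
assert (Hlim : forall p : C -> R,
  (forall z w : C, Rabs (p z - p w) <= Cmod (z - w))%R ->
  is_lim (fun h => p ((f (RtoC h) - f 0) / (RtoC h - 0))) 0 (p l)).
{ intros p Hp. apply is_lim_spec. intros eps.
  (* The denominator M + 1 covers the case M = 0. *)
  assert (He : (0 < eps / (M + 1))%R) by (apply Rdiv_lt_0_compat; [apply eps | lra]).
  exists (mkposreal _ He). intros h Hh Hh0.
  eapply Rle_lt_trans; [apply Hp|]. eapply Rle_lt_trans; [apply Hq, Hh0|].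
  change (Rabs (h - 0) < eps / (M + 1))%R in Hh. rewrite Rminus_0_r in Hh.
  apply Rmult_lt_compat_r with (r := (M + 1)%R) in Hh; [|lra].
  replace (eps / (M + 1) * (M + 1))%R with (pos eps) in Hh by (field; lra).
  pose proof (Rabs_pos h). nra. }
unfold C_derive, C_lim. rewrite (surjective_pairing l).
f_equal.
- refine (f_equal real (is_lim_unique _ _ _ (Hlim fst _))).
  intros z w. eapply Rle_trans; [|apply Rmax_Cmod]. apply Rmax_l.
- refine (f_equal real (is_lim_unique _ _ _ (Hlim snd _))).
  intros z w. eapply Rle_trans; [|apply Rmax_Cmod]. apply Rmax_r.
Qed.

Lemma theta_z_DTh (eps' eps : R) (tau : C) :
  (0 < Im tau)%R -> theta_z eps' eps 0 tau = DTh eps' eps tau.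
Proof.
intros Ht. pose proof PI_RGT_0 as Hpi.
assert (Hs := rapid_summable _ (rapid_theta_term eps' eps tau Ht)).
assert (Hds := rapid_summable _ (rapid_dtheta_term eps' eps tau Ht)).
destruct (rapid_weighted_theta_term eps' eps tau
  (fun n => RtoC ((2 * PI * (IZR n + eps')) ^ 2)%R) (16 * PI ^ 2)) as [K HK]; auto.
{ nra. }
{ intros n. rewrite Cmod_R, Rabs_pos_eq by apply pow2_ge_0.
  pose proof (pow_le_exp_Rabs (IZR n + eps')) as [_ [_ H]].
  replace ((2 * PI * (IZR n + eps')) ^ 2)%R with (4 * PI ^ 2 * (IZR n + eps') ^ 2)%R by ring.
  replace (16 * PI ^ 2 * exp (Rabs (IZR n + eps')))%R
    with (4 * PI ^ 2 * (4 * exp (Rabs (IZR n + eps'))))%R by ring.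
  apply Rmult_le_compat_l; nra. }
destruct (rapid_summable _ (ex_intro _ K HK)) as [L HL].
(* The 4 comes from [ZSeries_bound], the 2 from the Taylor bound, and [L] dominates the terms
   weighted by (2 pi (n + eps'))^2. *)
apply C_derive_of_bound with (M := (4 * (2 * L))%R). intros h.
change (theta eps' eps 0 tau) with (ZSeries (theta_term eps' eps tau)).
unfold theta, DTh.
(* Moving z from 0 to a real h multiplies the n-th term by this unimodular factor. *)
set (rot := fun n : Z => Cexp (Ci * RtoC (h * (2 * PI * (IZR n + eps'))))).
rewrite (ZSeries_ext _ (fun n => rot n * theta_term eps' eps tau n)).
2:{ intros n. unfold rot, theta_term. rewrite <- Cexp_plus. f_equal.
    rewrite !RtoC_mult, RtoC_plus. ring. }
assert (Hrs : summable (fun n => rot n * theta_term eps' eps tau n)).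
{ destruct Hs as [K0 H0]. exists K0. intros n. unfold rot.
  rewrite Cmod_mult, Cmod_Cexp. replace (Re _) with 0%R by (simpl; ring).
  rewrite exp_0, Rmult_1_l. apply H0. }
rewrite <- ZSeries_scal, <- ZSeries_minus, <- ZSeries_minus;
  auto using summable_scal, summable_minus.
replace (4 * (2 * L) * h ^ 2)%R with (4 * (2 * h ^ 2 * L))%R by ring.
apply ZSeries_bound. intros n. unfold dtheta_term.
set (t := (h * (2 * PI * (IZR n + eps')))%R) in *.
replace (_ - _ - _) with ((Cexp (Ci * t) - 1 - Ci * t) * theta_term eps' eps tau n).
2:{ unfold rot, t. rewrite !RtoC_mult, RtoC_plus. ring. }
rewrite Cmod_mult.
eapply Rle_trans; [apply Rmult_le_compat_r; [apply Cmod_ge_0 | apply Cexp_imaginary_taylor]|].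
specialize (HL n). cbv beta in HL. rewrite Cmod_mult, Cmod_R, Rabs_pos_eq in HL by apply pow2_ge_0.
unfold t. rewrite Rpow_mult_distr.
pose proof (pow2_ge_0 h). nra.
Qed.

(** * Product formulas from tau to 2 tau *)

(** With P = p + s' + k/2 and Q = q + t' + k/2 the shifted indices on the left are P + Q and P - Q.
    Their squares add up to 2 P^2 + 2 Q^2, and the linear parts to 2 P s + 2 Q t. *)
Lemma theta_term_mult (s' s t' t : R) (tau : C) (p q k : Z) :
  theta_term (s' + t') (s + t) tau (p + q + k) * theta_term (s' - t') (s - t) tau (p - q)
  = theta_term (s' + IZR k / 2) (2 * s) (2 * tau) p
    * theta_term (t' + IZR k / 2) (2 * t) (2 * tau) q.
Proof.
unfold theta_term. rewrite <- !Cexp_plus. f_equal.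
rewrite !minus_IZR, !plus_IZR, !RtoC_plus, !RtoC_minus, !RtoC_mult, RtoC_div by lra.
field.
Qed.

(** The derivative weight is that of P + Q, the sum of the weights of P and Q. *)
Lemma dtheta_term_mult_l (s' s t' t : R) (tau : C) (p q k : Z) :
  dtheta_term (s' + t') (s + t) tau (p + q + k) * theta_term (s' - t') (s - t) tau (p - q)
  = dtheta_term (s' + IZR k / 2) (2 * s) (2 * tau) p
    * theta_term (t' + IZR k / 2) (2 * t) (2 * tau) q
  + theta_term (s' + IZR k / 2) (2 * s) (2 * tau) p
    * dtheta_term (t' + IZR k / 2) (2 * t) (2 * tau) q.
Proof.
unfold dtheta_term. rewrite <- Cmult_assoc, theta_term_mult.
rewrite !plus_IZR, !RtoC_plus, RtoC_div by lra. field.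
Qed.

(** Now the weight is that of P - Q; its sign is put on the last factor to fit
    [ZSeries_separate2]. *)
Lemma dtheta_term_mult_r (s' s t' t : R) (tau : C) (p q k : Z) :
  theta_term (s' + t') (s + t) tau (p + q + k) * dtheta_term (s' - t') (s - t) tau (p - q)
  = dtheta_term (s' + IZR k / 2) (2 * s) (2 * tau) p
    * theta_term (t' + IZR k / 2) (2 * t) (2 * tau) q
  + theta_term (s' + IZR k / 2) (2 * s) (2 * tau) p
    * (-1 * dtheta_term (t' + IZR k / 2) (2 * t) (2 * tau) q).
Proof.
unfold dtheta_term. rewrite (Cmult_comm (theta_term _ _ _ (p + q + k))), <- Cmult_assoc.
rewrite (Cmult_comm _ (theta_term (s' + t') _ _ _)), theta_term_mult.
rewrite !minus_IZR, !RtoC_minus, !RtoC_plus, RtoC_div by lra. field.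
Qed.

Lemma Im_double_pos (tau : C) : (0 < Im tau)%R -> (0 < Im (2 * tau))%R.
Proof. destruct tau as [x y]. simpl. lra. Qed.

(** The form [0 / 2] is [IZR k / 2] at k = 0, left as the termwise formula yields it. *)
Lemma Th_mult (s' s t' t : R) (tau : C) : (0 < Im tau)%R ->
  Th (s' + t') (s + t) tau * Th (s' - t') (s - t) tau
  = Th (s' + 0 / 2) (2 * s) (2 * tau) * Th (t' + 0 / 2) (2 * t) (2 * tau)
    + Th (s' + 1 / 2) (2 * s) (2 * tau) * Th (t' + 1 / 2) (2 * t) (2 * tau).
Proof.
intros Ht. pose proof (Im_double_pos _ Ht) as Ht2.
unfold Th at 1 2. rewrite ZSeries_mult by now apply rapid_theta_term.
f_equal; (etransitivity; [apply ZSeries_ext; intros q; apply ZSeries_ext; intros p;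
    apply theta_term_mult|]);
  apply ZSeries_separate; now apply rapid_summable, rapid_theta_term.
Qed.

Lemma DTh_mult_l (s' s t' t : R) (tau : C) : (0 < Im tau)%R ->
  DTh (s' + t') (s + t) tau * Th (s' - t') (s - t) tau
  = (DTh (s' + 0 / 2) (2 * s) (2 * tau) * Th (t' + 0 / 2) (2 * t) (2 * tau)
     + Th (s' + 0 / 2) (2 * s) (2 * tau) * DTh (t' + 0 / 2) (2 * t) (2 * tau))
    + (DTh (s' + 1 / 2) (2 * s) (2 * tau) * Th (t' + 1 / 2) (2 * t) (2 * tau)
       + Th (s' + 1 / 2) (2 * s) (2 * tau) * DTh (t' + 1 / 2) (2 * t) (2 * tau)).
Proof.
intros Ht. pose proof (Im_double_pos _ Ht) as Ht2.
unfold Th at 1, DTh at 1.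
rewrite ZSeries_mult by (now apply rapid_theta_term || now apply rapid_dtheta_term).
f_equal; (etransitivity; [apply ZSeries_ext; intros q; apply ZSeries_ext; intros p;
    apply dtheta_term_mult_l|]);
  apply ZSeries_separate2; apply rapid_summable;
  (now apply rapid_theta_term || now apply rapid_dtheta_term).
Qed.

Lemma DTh_mult_r (s' s t' t : R) (tau : C) : (0 < Im tau)%R ->
  Th (s' + t') (s + t) tau * DTh (s' - t') (s - t) tau
  = (DTh (s' + 0 / 2) (2 * s) (2 * tau) * Th (t' + 0 / 2) (2 * t) (2 * tau)
     - Th (s' + 0 / 2) (2 * s) (2 * tau) * DTh (t' + 0 / 2) (2 * t) (2 * tau))
    + (DTh (s' + 1 / 2) (2 * s) (2 * tau) * Th (t' + 1 / 2) (2 * t) (2 * tau)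
       - Th (s' + 1 / 2) (2 * s) (2 * tau) * DTh (t' + 1 / 2) (2 * t) (2 * tau)).
Proof.
intros Ht. pose proof (Im_double_pos _ Ht) as Ht2.
assert (H : forall b' b, summable (dtheta_term b' b (2 * tau)))
  by (intros; now apply rapid_summable, rapid_dtheta_term).
unfold Th at 1, DTh at 1.
rewrite ZSeries_mult by (now apply rapid_theta_term || now apply rapid_dtheta_term).
f_equal; (etransitivity; [apply ZSeries_ext; intros q; apply ZSeries_ext; intros p;
    apply dtheta_term_mult_r|]);
  (rewrite ZSeries_separate2; [rewrite ZSeries_scal by easy; unfold Th, DTh; simpl; ring|..]);
  try apply summable_scal; apply rapid_summable;
  (now apply rapid_theta_term || now apply rapid_dtheta_term).
Qed.

(** * Reflection of characteristics *)

(** With m = -n - 1 one has n + 1 - a' = -(m + a'), so the quadratic part is unchanged. The linear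
    part differs by -2 pi i a' and a period 2 pi i (n + 1). *)
Lemma theta_term_reflect (a' a : R) (tau : C) (n : Z) :
  theta_term (1 - a') (1 - a) tau n
  = Cexp (- 2 * PI * Ci * a') * theta_term a' a tau (- n - 1).
Proof.
rewrite <- (Cmult_1_l (theta_term a' a tau (- n - 1))), <- (Cexp_period (n + 1)).
unfold theta_term. rewrite <- !Cexp_plus. f_equal.
rewrite !minus_IZR, !opp_IZR, !RtoC_minus, !RtoC_opp, !plus_IZR, RtoC_plus. ring.
Qed.

Lemma Th_reflect (a' a : R) (tau : C) : (0 < Im tau)%R ->
  Th (1 - a') (1 - a) tau = Cexp (- 2 * PI * Ci * a') * Th a' a tau.
Proof.
intros Ht. unfold Th.
rewrite <- (ZSeries_reflect (theta_term (1 - a') _ _)), <- ZSeries_scal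
  by now apply rapid_summable, rapid_theta_term.
apply ZSeries_ext. intros n. rewrite theta_term_reflect. do 2 f_equal. lia.
Qed.

(** The extra sign is that of the odd weight n + 1 - a' = -(m + a'). *)
Lemma DTh_reflect (a' a : R) (tau : C) : (0 < Im tau)%R ->
  DTh (1 - a') (1 - a) tau = - Cexp (- 2 * PI * Ci * a') * DTh a' a tau.
Proof.
intros Ht. unfold DTh.
rewrite <- (ZSeries_reflect (dtheta_term (1 - a') _ _)), <- ZSeries_scal
  by now apply rapid_summable, rapid_dtheta_term.
apply ZSeries_ext. intros n. unfold dtheta_term. rewrite theta_term_reflect.
replace (- (- n - 1) - 1)%Z with n by lia.
rewrite !minus_IZR, opp_IZR, !RtoC_minus, RtoC_opp. ring.
Qed.

Lemma Cexp_opp_PI_Ci : Cexp (- PI * Ci) = -1.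
Proof.
replace (- PI * Ci) with (Ci * RtoC (- PI)) by (rewrite RtoC_opp; ring).
rewrite Cexp_imaginary, cos_neg, sin_neg, cos_PI, sin_PI. unfold RtoC, Copp; simpl.
f_equal; ring.
Qed.

(** The characteristic is fixed by the reflection, whose factor here is -1. *)
Lemma Th_half_half (tau : C) : (0 < Im tau)%R -> Th (1 / 2) (1 / 2) tau = 0.
Proof.
intros Ht. pose proof (Th_reflect (1 / 2) (1 / 2) tau Ht) as H.
replace (1 - 1 / 2)%R with (1 / 2)%R in H by field.
replace (- 2 * PI * Ci * (1 / 2)%R) with (- PI * Ci) in H by (rewrite RtoC_div by lra; field).
rewrite Cexp_opp_PI_Ci in H.
replace (Th (1 / 2) (1 / 2) tau)
  with ((Th (1 / 2) (1 / 2) tau - -1 * Th (1 / 2) (1 / 2) tau) / 2) by field.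
rewrite <- H. field.
Qed.

(** * The cubic identity *)

Theorem theorem1 (tau : C) (eps' eps : R) (Htau : (0 < Im tau)%R) :
  theta eps' eps 0 tau ^ 2 *
    (3 * theta (3 * eps') (3 * eps) 0 tau * theta_z eps' eps 0 tau
     - theta_z (3 * eps') (3 * eps) 0 tau * theta eps' eps 0 tau)
  = Cexp (6 * PI * Ci * eps') * theta_z (1 / 2) (1 / 2) 0 tau
    * theta (1 / 2 - 2 * eps') (1 / 2 - 2 * eps) 0 tau ^ 3.
Proof.
rewrite !theta_z_DTh by easy.
change (theta ?x ?y 0 tau) with (Th x y tau).
pose proof (Im_double_pos _ Htau) as Htau2.
set (h' := (1 / 2 - 2 * eps')%R). set (h := (1 / 2 - 2 * eps)%R).
pose proof (Th_mult (2 * eps') (2 * eps) eps' eps tau Htau) as E1.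
pose proof (DTh_mult_l (2 * eps') (2 * eps) eps' eps tau Htau) as E2.
pose proof (DTh_mult_r (2 * eps') (2 * eps) eps' eps tau Htau) as E3.
replace (2 * eps' + eps')%R with (3 * eps')%R in * by ring.
replace (2 * eps + eps)%R with (3 * eps)%R in * by ring.
replace (2 * eps' - eps')%R with eps' in * by ring.
replace (2 * eps - eps)%R with eps in * by ring.
pose proof (Th_mult eps' eps 0 0 tau Htau) as E4.
pose proof (DTh_mult_l eps' eps 0 0 tau Htau) as E5.
pose proof (DTh_mult_r eps' eps 0 0 tau Htau) as E6.
rewrite !Rplus_0_r, !Rminus_0_r in E4, E5, E6.
pose proof (Th_mult h' h 0 0 tau Htau) as E7.
rewrite !Rplus_0_r, !Rminus_0_r in E7.
pose proof (DTh_mult_l (1 / 2 - eps') (1 / 2 - eps) eps' eps tau Htau) as E8.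
pose proof (DTh_mult_r (1 / 2 - eps') (1 / 2 - eps) eps' eps tau Htau) as E9.
replace (1 / 2 - eps' + eps')%R with (1 / 2)%R in * by ring.
replace (1 / 2 - eps + eps)%R with (1 / 2)%R in * by ring.
replace (1 / 2 - eps' - eps')%R with h' in * by (unfold h'; ring).
replace (1 / 2 - eps - eps)%R with h in * by (unfold h; ring).
rewrite (Th_half_half tau Htau) in E9.
(* Reflection brings the constants on the right back to the a_k and f_k, exchanging k = 0 and k =
   1. *)
replace (h' + 0 / 2)%R with (1 - (2 * eps' + 1 / 2))%R in E7 by (unfold h'; field).
replace (h' + 1 / 2)%R with (1 - (2 * eps' + 0 / 2))%R in E7 by (unfold h'; field).
replace (2 * h)%R with (1 - 2 * (2 * eps))%R in E7 by (unfold h; field).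
replace (1 / 2 - eps' + 0 / 2)%R with (1 - (eps' + 1 / 2))%R in * by field.
replace (1 / 2 - eps' + 1 / 2)%R with (1 - (eps' + 0 / 2))%R in * by field.
replace (2 * (1 / 2 - eps))%R with (1 - 2 * eps)%R in * by field.
rewrite !Th_reflect in E7 by easy.
rewrite !DTh_reflect in E8, E9 by easy.
set (u := Cexp (- 2 * PI * Ci * eps')).
assert (U0 : Cexp (- 2 * PI * Ci * (eps' + 0 / 2)%R) = u).
{ replace (eps' + 0 / 2)%R with eps' by field. easy. }
assert (U1 : Cexp (- 2 * PI * Ci * (eps' + 1 / 2)%R) = - u).
{ replace (- 2 * PI * Ci * (eps' + 1 / 2)%R) with (- 2 * PI * Ci * eps' + - PI * Ci).
  - rewrite Cexp_plus, Cexp_opp_PI_Ci. unfold u. ring.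
  - rewrite RtoC_plus, RtoC_div by lra. field. }
assert (V0 : Cexp (- 2 * PI * Ci * (2 * eps' + 0 / 2)%R) = u * u).
{ unfold u. rewrite <- Cexp_plus. f_equal. rewrite RtoC_plus, RtoC_div, RtoC_mult by lra. field. }
assert (V1 : Cexp (- 2 * PI * Ci * (2 * eps' + 1 / 2)%R) = - (u * u)).
{ replace (- 2 * PI * Ci * (2 * eps' + 1 / 2)%R)
    with (- 2 * PI * Ci * eps' + - 2 * PI * Ci * eps' + - PI * Ci).
  - rewrite !Cexp_plus, Cexp_opp_PI_Ci. unfold u. ring.
  - rewrite RtoC_plus, RtoC_div, RtoC_mult by lra. field. }
(* The exponential of the theorem cancels the reflection factors: [u] from [E8] and u^2 from
   [E7]. *)
assert (W : Cexp (6 * PI * Ci * eps') * (u * u * u) = 1).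
{ unfold u. rewrite <- !Cexp_plus, <- Cexp_0. f_equal. ring. }
rewrite U0, U1 in E8, E9. rewrite V0, V1 in E7.
set (v := Cexp (6 * PI * Ci * eps')) in *.
set (x := Th eps' eps tau) in *. set (x' := DTh eps' eps tau) in *.
set (y := Th (3 * eps') (3 * eps) tau) in *. set (y' := DTh (3 * eps') (3 * eps) tau) in *.
set (z := Th h' h tau) in *. set (o' := DTh (1 / 2) (1 / 2) tau) in *.
set (f0 := Th (eps' + 0 / 2) (2 * eps) (2 * tau)) in *.
set (f1 := Th (eps' + 1 / 2) (2 * eps) (2 * tau)) in *.
set (f0' := DTh (eps' + 0 / 2) (2 * eps) (2 * tau)) in *.
set (f1' := DTh (eps' + 1 / 2) (2 * eps) (2 * tau)) in *.
set (a0 := Th (2 * eps' + 0 / 2) (2 * (2 * eps)) (2 * tau)) in *.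
set (a1 := Th (2 * eps' + 1 / 2) (2 * (2 * eps)) (2 * tau)) in *.
set (c0 := Th (0 + 0 / 2) (2 * 0) (2 * tau)) in *.
set (c1 := Th (0 + 1 / 2) (2 * 0) (2 * tau)) in *.
(* Adding [E5] and [E6] cancels the derivatives of the c_k. *)
assert (Ex : 2 * (x * x') = 2 * (f0' * c0 + f1' * c1)).
{ replace (2 * (x * x')) with (x' * x + x * x') by ring. rewrite E5, E6. ring. }
(* After reflection the four products in [E8] pair off into twice a Wronskian of f_0 and f_1. *)
assert (Eo : o' * z = 2 * u * (f0 * f1' - f1 * f0')).
{ replace (o' * z) with (o' * z + 0 * DTh h' h tau) by ring.
  rewrite E8, E9. ring. }
(* The difference of [E3] and [E2] cancels the derivatives of the a_k. *)
assert (Ey : y * x' - y' * x = - 2 * (a0 * f0' + a1 * f1')).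
{ rewrite E2, E3. ring. }
transitivity (2 * (a0 * c1 - a1 * c0) * (f0 * f1' - f1 * f0')).
(* After substitution this is the Binet-Cauchy identity (a.f)(c.f') - (a.f')(c.f) = det(a, c) det(f,
   f') in dimension 2. *)
- replace (x ^ 2 * (3 * y * x' - y' * x))
    with (x * x * (y * x' - y' * x) + y * x * (2 * (x * x'))) by ring.
  rewrite Ex, Ey, E1, E4. ring.
- replace (v * o' * z ^ 3) with (v * (o' * z) * (z * z)) by ring.
  (* By [E7], z^2 = u^2 (a_0 c_1 - a_1 c_0). *)
  rewrite Eo, E7.
  replace (2 * (a0 * c1 - a1 * c0) * (f0 * f1' - f1 * f0'))
    with (v * (u * u * u) * (2 * (a0 * c1 - a1 * c0) * (f0 * f1' - f1 * f0')))
    by (rewrite W; ring).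
  ring.
Qed.
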